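(* Let $\alpha\in\mathbb{Z}[i]$ be nonzero, let $L=\mathbb{Z}[i]/\alpha\mathbb{Z}[i]$, and let $(L,(R_i)_{i\in I})$ be the association scheme on $L$ whose relations are the orbitals of the group $\mathcal{H}=\mathcal{G}\ltimes\mathcal{T}$ acting on $L$, where $R_k$ corresponds to the $\mathcal{G}$-orbit $O_k\subset L$. If this scheme is imprimitive, then there is a set of indices $\tilde 0\subset I$, consisting of $0$ together with the indices $k$ of the orbits $O_k$ of the elements of some nonempty set of nonzero zero divisors of the ring $L$, such that the quotient scheme $(\tilde X,\tilde{\mathcal R})$ of $(L,(R_i)_{i\in I})$ with respect to $\tilde 0$ is defined (i.e. $\bigcup_{i\in\tilde 0}R_i$ is an equivalence relation on $L$, the relation $\sim$ on $I$ is an equivalence relation with $\tilde 0$ as the class of $0$, and $(\tilde X,\tilde{\mathcal R})$ is an association scheme).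
   Context: $\mathcal{G}=\langle i\rangle=\{\pm1,\pm i\}$ is the group of units of the Gaussian integers $\mathbb{Z}[i]$, acting on $L$ by multiplication; $\mathcal{T}$ is the group of translations $x\mapsto x+\beta$ ($\beta\in L$) of $L$; $\mathcal{H}=\mathcal{G}\ltimes\mathcal{T}$ is regarded as the permutation group on $L$ generated by $x\mapsto ix$ and the translations. The orbitals are the orbits of the induced action of $\mathcal{H}$ on $L\times L$; equivalently, the relations $R_k$, $k\in I$, correspond to the $\mathcal{G}$-orbits $O_k$ on $L$ via $(x,y)\in R_k\Leftrightarrow x-y\in O_k$, with $O_0=\{0\}$. Let $X$ be a finite set. A $d$-class association scheme is a pair $(X,(R_i)_{i\in I})$, $I=\{0,1,\dots,d\}$, such that: (1) $(R_i)_{i\in I}$ is a partition of $X\times X$; (2) for every $i\in I$ there is $j\in I$ with $R_i^t=R_j$, where $R_i^t=\{(y,x) : (x,y)\in R_i\}$; (3) $R_0=\{(x,x) : x\in X\}$; (4) there are numbers $p_{ij}^k$ such that for any $(x,y)\in R_k$ the number of $z\in X$ with $(x,z)\in R_i$ and $(z,y)\in R_j$ equals $p_{ij}^k$; (5) $p_{ij}^k=p_{ji}^k$ for all $i,j,k\in I$. It is imprimitive if some union of relations is an equivalence relation distinct from the trivial ones ($R_0$ and $X\times X$). Quotient scheme: given an association scheme $(X,(R_i)_{i\in I})$ and a set of indices $\tilde 0\subset I$ containing $0$ such that $\bigcup_{i\in\tilde 0}R_i$ is an equivalence relation on $X$, define $a\sim b$ for $a,b\in I$ if $p_{ab}^i\neq0$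 for some $i\in\tilde 0$, and write $\tilde a$ for the class of $a$ under $\sim$. The quotient scheme with respect to $\tilde 0$ is the association scheme whose point set $\tilde X$ is the set of equivalence classes $\tilde x$ of points $x\in X$ under $\bigcup_{i\in\tilde 0}R_i$, and whose relations are $$\tilde R_{\tilde i}=\{(\tilde x,\tilde y) : \text{for } x\in\tilde x,\ y\in\tilde y \text{ we have } (x,y)\in R_j \text{ with } j\in\tilde i\}.$$ *)

(* Defs.v *)
From HB Require Import structures.
From mathcomp Require Import all_boot all_order all_fingroup all_algebra.
From mathcomp Require Import ring boolp.

Set Implicit Arguments.
Unset Strict Implicit.
Unset Printing Implicit Defensive.

Import Order.TTheory GRing.Theory Num.Theory.

Local Open Scope ring_scope.

Definition is_equivalence (X : finType) (E : {set X * X}) : Prop :=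
  equivalence_rel (fun x y : X => (x, y) \in E).

(* The index set is any finite type with a distinguished element i0 in the   *)
(* role of 0. It is 'I_d.+1 with ord0 for a d-class scheme, and a set of     *)
(* classes of indices for a quotient scheme.                                 *)
(* The relations are pairwise distinct and nonempty (set0 is never a block   *)
(* of a partition), so inum is determined by arel.                           *)
Record assoc_scheme (X I : finType) (i0 : I) := AssocScheme {
  arel : I -> {set X * X};
  inum : I -> I -> I -> nat;
  arel_inj : injective arel;
  arel_partition : partition [set arel i | i : I] [set: X * X];
  arel_tr : forall i, exists j, [set (xy.2, xy.1) | xy in arel i] = arel j;
  arel_diag : arel i0 = [set (x, x) | x : X];
  inumP : forall i j k x y, (x, y) \in arel k ->
    #|[set z | ((x, z) \in arel i) && ((z, y) \in arel j)]| = inum i j k;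
  inumC : forall i j k, inum i j k = inum j i k
}.

Section Quotient.

Variables (X I : finType) (i0 : I) (S : assoc_scheme X i0).
Implicit Types (T : {set I}) (a b i j : I) (x y : X).

Definition arel_union T : {set X * X} := \bigcup_(i in T) arel S i.

Definition imprimitive : Prop :=
  exists T, [/\ is_equivalence (arel_union T),
                arel_union T != arel S i0
              & arel_union T != [set: X * X]].

Definition sim T a b : bool := [exists i in T, inum S a b i != 0%N].

Definition index_class T a : {set I} := [set b | sim T a b].
Definition point_class T x : {set X} := [set y | (x, y) \in arel_union T].

Definition quot_point T := {A : {set X} | A \in [set point_class T x | x : X]}.
Definition quot_index T := {C : {set I} | C \in [set index_class T a | a : I]}.

Fact index_class0 T : index_class T i0 \in [set index_class T a | a : I].
Proof. exact: imset_f. Qed.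

Definition quot_index0 T : quot_index T :=
  exist _ (index_class T i0) (index_class0 T).

(* The relation is required of all representatives x and y; the index j may  *)
(* depend on them.                                                           *)
Definition quot_rel T (C : quot_index T) : {set quot_point T * quot_point T} :=
  [set AB : quot_point T * quot_point T |
     [forall x in sval AB.1, forall y in sval AB.2,
        exists j in sval C, (x, y) \in arel S j]].

Definition quotient_defined T : Prop :=
  [/\ is_equivalence (arel_union T),
      equivalence_rel (sim T),
      index_class T i0 = T
    & exists Q : assoc_scheme (quot_point T) (quot_index0 T),
        forall C, arel Q C = quot_rel C].

End Quotient.

Record gaussInt := GaussInt { gre : int; gim : int }.

Definition pair_of_gauss (x : gaussInt) := (gre x, gim x).
Definition gauss_of_pair (p : int * int) := GaussInt p.1 p.2.
Lemma pair_of_gaussK : cancel pair_of_gauss gauss_of_pair.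
Proof. by case. Qed.

HB.instance Definition _ := Countable.copy gaussInt (can_type pair_of_gaussK).

Definition gadd x y := GaussInt (gre x + gre y) (gim x + gim y).
Definition gopp x := GaussInt (- gre x) (- gim x).
Definition gmul x y := GaussInt (gre x * gre y - gim x * gim y)
                                (gre x * gim y + gim x * gre y).

Fact gaddA : associative gadd.
Proof. by move=> [a b] [c d] [e f]; congr GaussInt => /=; ring. Qed.
Fact gaddC : commutative gadd.
Proof. by move=> [a b] [c d]; congr GaussInt => /=; ring. Qed.
Fact gadd0 : left_id (GaussInt 0 0) gadd.
Proof. by move=> [a b]; congr GaussInt => /=; ring. Qed.
Fact gaddN : left_inverse (GaussInt 0 0) gopp gadd.
Proof. by move=> [a b]; congr GaussInt => /=; ring. Qed.
HB.instance Definition _ :=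
  GRing.isZmodule.Build gaussInt gaddA gaddC gadd0 gaddN.

Fact gmulA : associative gmul.
Proof. by move=> [a b] [c d] [e f]; congr GaussInt => /=; ring. Qed.
Fact gmulC : commutative gmul.
Proof. by move=> [a b] [c d]; congr GaussInt => /=; ring. Qed.
Fact gmul1 : left_id (GaussInt 1 0) gmul.
Proof. by move=> [a b]; congr GaussInt => /=; ring. Qed.
Fact gmulDl : left_distributive gmul gadd.
Proof. by move=> [a b] [c d] [e f]; congr GaussInt => /=; ring. Qed.
Fact g1_neq0 : GaussInt 1 0 != 0.
Proof. by []. Qed.
HB.instance Definition _ := GRing.Zmodule_isComNzRing.Build gaussInt
  gmulA gmulC gmul1 gmulDl g1_neq0.

Definition gI : gaussInt := GaussInt 0 1.

Definition principal (alpha : gaussInt) : {pred gaussInt} :=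
  fun x => `[< exists y, x = alpha * y >].

Fact principal_zmod_closed alpha : zmod_closed (principal alpha).
Proof.
split; first by apply/asboolP; exists 0; rewrite mulr0.
move=> _ _ /asboolP[x ->] /asboolP[y ->].
by apply/asboolP; exists (x - y); rewrite mulrBr.
Qed.
HB.instance Definition _ alpha :=
  GRing.isZmodClosed.Build gaussInt (principal alpha)
    (principal_zmod_closed alpha).

Section GaussQuotient.

Variables (alpha : gaussInt) (alpha_neq0 : alpha != 0).

(* {ideal_quot _} is only a ring for proper ideals, whereas alpha may be a   *)
(* unit, in which case the quotient is the zero ring. Hence the quotient is  *)
(* taken as an additive group and then given its multiplication.             *)
(* Finiteness needs alpha != 0, so the type carries this proof.              *)
Definition gquot : Type :=
  let _ := alpha_neq0 in @Quotient.quot gaussInt (principal alpha).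

HB.instance Definition _ := GRing.Zmodule.on gquot.

Definition gpi (x : gaussInt) : gquot :=
  \pi_(@Quotient.quot gaussInt (principal alpha))%qT x.
Definition grepr (x : gquot) : gaussInt :=
  generic_quotient.repr (x : @Quotient.quot gaussInt (principal alpha)).

Lemma greprK : cancel grepr gpi.
Proof. exact: reprK. Qed.

Lemma gpi_eq x y : (gpi x == gpi y) = (x - y \in principal alpha).
Proof. by rewrite -Quotient.idealrBE. Qed.

Lemma gpi_eqP x y : reflect (exists z, x - y = alpha * z) (gpi x == gpi y).
Proof. by rewrite gpi_eq; apply: asboolP. Qed.

Lemma gpi0 : gpi 0 = 0. Proof. by rewrite /gpi raddf0. Qed.
Lemma gpiD x y : gpi (x + y) = gpi x + gpi y.
Proof. by rewrite /gpi raddfD. Qed.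
Lemma gpiN x : gpi (- x) = - gpi x.
Proof. by rewrite /gpi raddfN. Qed.

Definition gqmul (x y : gquot) : gquot := gpi (grepr x * grepr y).

Lemma gpiM x y : gpi (x * y) = gqmul (gpi x) (gpi y).
Proof.
have /gpi_eqP[a xa] : gpi x == gpi (grepr (gpi x)) by rewrite greprK.
have /gpi_eqP[b yb] : gpi y == gpi (grepr (gpi y)) by rewrite greprK.
apply/eqP/gpi_eqP; exists (a * y + grepr (gpi x) * b).
by rewrite mulrDr mulrA -xa mulrCA -yb mulrBl mulrBr addrA subrK.
Qed.

Fact gqmulA : associative gqmul.
Proof.
move=> x y z; rewrite -(greprK x) -(greprK y) -(greprK z).
by rewrite -!gpiM mulrA.
Qed.
Fact gqmulC : commutative gqmul.
Proof. by move=> x y; rewrite /gqmul mulrC. Qed.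
Fact gqmul1 : left_id (gpi 1) gqmul.
Proof. by move=> x; rewrite -(greprK x) -gpiM mul1r. Qed.
Fact gqmulDl : left_distributive gqmul +%R.
Proof.
move=> x y z; rewrite -(greprK x) -(greprK y) -(greprK z).
by rewrite -!gpiM -!gpiD -gpiM mulrDl.
Qed.
HB.instance Definition _ := GRing.Zmodule_isComPzRing.Build gquot
  gqmulA gqmulC gqmul1 gqmulDl.

Let N : int := gre alpha ^+ 2 + gim alpha ^+ 2.

Lemma gnorm_gt0 : 0 < N.
Proof.
rewrite lt_neqAle addr_ge0 ?sqr_ge0 // andbT eq_sym.
rewrite paddr_eq0 ?sqr_ge0 // !sqrf_eq0; apply: contra alpha_neq0.
by case: (alpha) => a b /= /andP[/eqP-> /eqP->].
Qed.

Let code (x : gquot) : 'I_(`|N|.-1).+1 * 'I_(`|N|.-1).+1 :=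
  (inord (absz (gre (grepr x) %% N)%Z), inord (absz (gim (grepr x) %% N)%Z)).
Let decode (p : 'I_(`|N|.-1).+1 * 'I_(`|N|.-1).+1) : gquot :=
  gpi (GaussInt (Posz p.1) (Posz p.2)).

Fact codeK : cancel code decode.
Proof.
move=> x; rewrite -[RHS]greprK /code /decode /=.
have N0 := gnorm_gt0.
have inordZ a : Posz (@inord `|N|.-1 (absz (a %% N)%Z)) = (a %% N)%Z.
  rewrite inordK ?gez0_abs ?modz_ge0 ?gt_eqF // prednK ?absz_gt0 ?gt_eqF //.
  by rewrite -ltz_nat !gez0_abs ?modz_ge0 ?gt_eqF ?ltW // ltz_pmod.
rewrite !inordZ; case: (grepr x) => a b /=.
apply/eqP/gpi_eqP.
exists (GaussInt (gre alpha) (- gim alpha) *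
        GaussInt (- (a %/ N)%Z) (- (b %/ N)%Z)).
rewrite mulrA; have -> : alpha * GaussInt (gre alpha) (- gim alpha) =
   GaussInt N 0 by congr GaussInt; rewrite /= /N; ring.
have ea := divz_eq a N; have eb := divz_eq b N.
move: (modz a N) (divz a N) (modz b N) (divz b N) ea eb => ra qa rb qb -> ->.
rewrite -[LHS]/(GaussInt (ra - (qa * N + ra)) (rb - (qb * N + rb))).
by congr GaussInt; rewrite /=; move: N => n; ring.
Qed.

HB.instance Definition _ := CanIsCountable codeK.
HB.instance Definition _ := isFinite.Build gquot (pcan_enumP (can_pcan codeK)).

Definition qI : gquot := gpi gI.

Lemma qI2 : qI * qI = -1.
Proof. by rewrite /qI -[_ * _]gpiM -[1]/(gpi 1) -gpiN. Qed.

Lemma mulI_inj : injective (fun x : gquot => qI * x).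
Proof.
move=> x y /(congr1 ( *%R qI)).
by rewrite !mulrA qI2 !mulN1r => /oppr_inj.
Qed.

Definition mulI_perm : {perm gquot} := perm mulI_inj.
Definition trans_perm (b : gquot) : {perm gquot} := perm (addIr b).

Definition unit_group : {group {perm gquot}} := <[mulI_perm]>%G.
Definition affine_group : {group {perm gquot}} :=
  <<mulI_perm |: [set trans_perm b | b : gquot]>>%G.

Definition unit_orbits : {set {set gquot}} :=
  [set orbit 'P unit_group x | x : gquot].

Definition orbitals : {set {set gquot * gquot}} :=
  [set [set (h xy.1, h xy.2) | h : {perm gquot} in affine_group]
     | xy : gquot * gquot].

(* The scheme axioms force O to be injective and O ord0 = [set 0].           *)
Definition is_orbital_scheme d (S : assoc_scheme gquot (ord0 : 'I_d.+1))
    (O : 'I_d.+1 -> {set gquot}) : Prop :=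
  [/\ [set arel S k | k : 'I_d.+1] = orbitals,
      [set O k | k : 'I_d.+1] = unit_orbits
    & forall k x y, ((x, y) \in arel S k) = (x - y \in O k)].

Definition zero_divisor (x : gquot) : Prop := exists2 y, y != 0 & x * y = 0.

End GaussQuotient.

Section OrbitalScheme.

Variables (alpha : gaussInt) (alpha_neq0 : alpha != 0).
Local Notation L := (gquot alpha_neq0).
Local Notation qI := (qI alpha_neq0).
Local Notation G := (unit_group alpha_neq0).
Local Notation H := (affine_group alpha_neq0).
Local Notation orb := (fun x : L => orbit 'P G x).
Implicit Types x y z : L.

Lemma mulI_permX n x : (mulI_perm alpha_neq0 ^+ n)%g x = qI ^+ n * x.
Proof.
elim: n x => [|n IHn] x; first by rewrite expg0 perm1 expr0 mul1r.
by rewrite expgSr permM IHn permE exprS mulrA.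
Qed.

Lemma unit_orbitP x y :
  reflect (exists n, y = qI ^+ n * x) (y \in orb x).
Proof.
apply: (iffP orbitP) => [[_ /cycleP[n ->] <-]|[n ->]].
  by exists n; rewrite /= apermE mulI_permX.
by exists (mulI_perm alpha_neq0 ^+ n)%g; rewrite ?mem_cycle //= apermE mulI_permX.
Qed.

Lemma qI4 : qI ^+ 4 = 1.
Proof. by rewrite (exprM _ 2 2) [qI ^+ 2]expr2 qI2 expr2 mulrNN mulr1. Qed.

Lemma unit_orbitN x y : (- y \in orb x) = (y \in orb x).
Proof.
suff imp z : z \in orb x -> - z \in orb x.
  by apply/idP/idP => /imp; rewrite ?opprK.
case/unit_orbitP=> n ->; apply/unit_orbitP; exists n.+2.
by rewrite !exprS [qI * (_ * _)]mulrA qI2 !mulNr mul1r.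
Qed.

Lemma unit_orbitM n x y : (qI ^+ n * y \in orb x) = (y \in orb x).
Proof.
by rewrite -mulI_permX -apermE orbit_actr ?mem_cycle.
Qed.

Definition diff_rel (A : {set L}) : {set L * L} := [set xy | xy.1 - xy.2 \in A].

Lemma affine_diff h x y : h \in H -> h x - h y \in orb (x - y).
Proof.
case/gen_prodgP=> m [c cA ->]; elim: m c cA => [|m IHm] c cA.
  by rewrite big_ord0 !perm1 orbit_refl.
rewrite big_ord_recr /= !permM.
have {}IHm := IHm _ (fun i => cA (widen_ord (leqnSn m) i)).
set u := (\prod_(i < m) _)%g in IHm *.
have := cA ord_max; rewrite !inE => /orP[/eqP->|/imsetP[b _ ->]].
  by rewrite !permE -mulrBr -(expr1 qI) unit_orbitM.
by rewrite !permE opprD addrACA subrr addr0.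
Qed.

Lemma orbitalE x y :
  [set (h (x, y).1, h (x, y).2) | h : {perm L} in H] = diff_rel (orb (x - y)).
Proof.
apply/setP=> -[x' y']; rewrite inE /=; apply/imsetP/idP.
  by case=> h Hh [-> ->]; apply: affine_diff.
case/unit_orbitP=> n e.
pose b := x' - qI ^+ n * x.
exists (mulI_perm alpha_neq0 ^+ n * trans_perm b)%g.
  rewrite groupM ?groupX ?mem_gen // !inE ?eqxx //.
  by apply/orP; right; apply: imset_f.
rewrite !permM !mulI_permX !permE /b; congr (_, _).
  by rewrite addrC subrK.
by rewrite -[LHS](subKr x') e mulrBr opprB addrCA.
Qed.

Let Os : seq {set L} :=
  [set 0] :: enum (unit_orbits alpha_neq0 :\ [set 0]).
Let d := #|unit_orbits alpha_neq0 :\ [set 0]|.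
Let O (k : 'I_d.+1) : {set L} := nth set0 Os k.

Let sizeOs : size Os = d.+1.
Proof. by rewrite /= -cardE. Qed.

Let unit_orbit0 : orb 0 = [set 0].
Proof.
apply/setP=> y; rewrite inE; apply/unit_orbitP/eqP => [[n ->]|->].
  by rewrite mulr0.
by exists 0%N; rewrite mulr0.
Qed.

Let mem_Os A : (A \in Os) = (A \in unit_orbits alpha_neq0).
Proof.
rewrite inE mem_enum !inE; case: eqP => //= ->.
by apply/esym/imsetP; exists 0; rewrite ?unit_orbit0.
Qed.

Let O_inj : injective O.
Proof.
have uOs : uniq Os by rewrite /= enum_uniq mem_enum !inE eqxx.
move=> i j /eqP; rewrite /O nth_uniq ?sizeOs // => /eqP; exact: val_inj.
Qed.

Let O_orb k : exists x, O k = orb x.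
Proof.
have : O k \in Os by rewrite mem_nth ?sizeOs.
by rewrite mem_Os => /imsetP[x _ ->]; exists x.
Qed.

Let orb_O x : exists k, O k = orb x.
Proof.
have : orb x \in Os by rewrite mem_Os imset_f.
move=> ox; have lt : (index (orb x) Os < d.+1)%N by rewrite -sizeOs index_mem.
by exists (Ordinal lt); rewrite /O nth_index.
Qed.

Let rl k := diff_rel (O k).

Let rl_inj : injective rl.
Proof.
move=> i j /setP e; apply: O_inj; apply/setP=> x.
by have := e (x, 0); rewrite !inE /= subr0.
Qed.

Let O_eq k x : x \in O k -> O k = orb x.
Proof.
by case: (O_orb k) => r ->; move/orbit_in_eqP => -> //; apply: subsetT.
Qed.

Let rl_partition : partition [set rl k | k : 'I_d.+1] [set: L * L].
Proof.
apply/and3P; split.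
- apply/eqP/setP=> -[x y]; rewrite inE; apply/bigcupP.
  have [k e] := orb_O (x - y); exists (rl k); first exact: imset_f.
  by rewrite inE /= e orbit_refl.
- apply/trivIsetP=> _ _ /imsetP[i _ ->] /imsetP[j _ ->] nij.
  rewrite -setI_eq0; apply: contraNT nij => /set0Pn[[x y]].
  by rewrite !inE /= => /andP[/O_eq ei /O_eq ej]; rewrite /rl ei ej.
- apply/imsetP=> -[k _] /setP e; case: (O_orb k) => x ox.
  by have := e (x, 0); rewrite !inE /= subr0 ox orbit_refl.
Qed.

Let cnt i j x y := #|[set z | ((x, z) \in rl i) && ((z, y) \in rl j)]|.

Let cnt_diff i j k x y x' y' :
  (x, y) \in rl k -> (x', y') \in rl k -> cnt i j x y = cnt i j x' y'.
Proof.
rewrite !inE /= => /O_eq -> /unit_orbitP[n e].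
pose f z := qI ^+ n * (z - y) + y'.
have f_inj : injective f.
  move=> z1 z2 /addIr/(congr1 ( *%R (qI ^+ (3 * n)))).
  by rewrite !mulrA -exprD -mulSnr exprM qI4 expr1n !mul1r => /addIr.
have [gf fK gK] := injF_bij f_inj.
rewrite /cnt -(card_imset _ f_inj); apply: eq_card => z'.
rewrite -(gK z') (mem_imset _ _ f_inj); move: (gf z') => z.
rewrite !inE /= /f addrK.
have -> : x' - (qI ^+ n * (z - y) + y') = qI ^+ n * (x - z).
  by rewrite opprD addrA addrAC e -mulrBr opprB addrA subrK.
case: (O_orb i) => a ->; case: (O_orb j) => b ->.
by rewrite !unit_orbitM.
Qed.

Let num i j k :=
  if [pick xy in rl k] is Some xy then cnt i j xy.1 xy.2 else 0%N.

Let numP i j k x y : (x, y) \in rl k -> cnt i j x y = num i j k.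
Proof.
rewrite /num => xyk; case: pickP => [[x' y'] x'y'k|/(_ (x, y))]; last by rewrite xyk.
exact: cnt_diff xyk x'y'k.
Qed.

Let numC i j k : num i j k = num j i k.
Proof.
rewrite /num; case: pickP => // -[x y] _ /=.
have f_inj : injective (fun z => x + y - z) by move=> z1 z2 /addrI/oppr_inj.
rewrite /cnt -(card_imset _ f_inj); apply: eq_card => z.
rewrite -{1}[z](subKr (x + y)) (mem_imset _ _ f_inj) !inE /= andbC.
have -> : x - (x + y - z) = z - y by ring.
by have -> : x + y - z - y = x - z by ring.
Qed.

Let rl_tr i : exists j, [set (xy.2, xy.1) | xy in rl i] = rl j.
Proof.
exists i; apply/setP=> -[x y]; case: (O_orb i) => r e.
apply/imsetP/idP => [[[u v] + [-> ->]]|xy]; last exists (y, x) => //.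
  by rewrite !inE /= e -unit_orbitN opprB.
by move: xy; rewrite !inE /= e -unit_orbitN opprB.
Qed.

Let rl_diag : rl ord0 = [set (x, x) | x : L].
Proof.
apply/setP=> -[x y]; rewrite !inE /= subr_eq0.
by apply/eqP/imsetP => [->|[z _ [-> ->]]] //; exists y.
Qed.

Lemma orbital_scheme_exists :
  exists d (S : assoc_scheme L (ord0 : 'I_d.+1)) O, is_orbital_scheme S O.
Proof.
exists d, (AssocScheme rl_inj rl_partition rl_tr rl_diag numP numC), O.
split=> /= [||k x y]; last by rewrite inE.
- apply/setP=> A; apply/imsetP/imsetP => [[k _ ->]|[[x y] _ ->]].
    case: (O_orb k) => r e; exists (r, 0) => //.
    by rewrite orbitalE subr0 /rl e.
  by have [k e] := orb_O (x - y); exists k => //; rewrite orbitalE /rl e.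
- apply/setP=> A; apply/imsetP/imsetP => [[k _ ->]|[x _ ->]].
    by case: (O_orb k) => r e; exists r.
  by have [k e] := orb_O x; exists k.
Qed.

End OrbitalScheme.

(* Main.v *)
Require Import Defs.
From mathcomp Require Import all_boot all_order all_fingroup all_algebra.

(** Let [T] be a set of indices whose union [E] of relations is a nontrivial
    equivalence relation on [L].  Every relation depends only on the difference
    of its arguments, so the [E]-class [J] of [0] is a subgroup of [L] and [E] is
    congruence modulo [J].  As a union of orbits of the units, [J] is stable under
    multiplication by [i]; since [1] and [i] generate [L] additively, [J] is an
    ideal ([ideal_mul]).  It is neither [0] nor [L] because [E] is nontrivial.
    Multiplication by an element of [J] maps [L] into [J], so it is not surjective,
    hence not injective as [L] is finite: all elements of [J] are zero divisors
    ([proper_ideal_zero_divisor]).  The nonzero elements of [J] form the required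
    set, and the indices of their orbits, together with [0], are exactly [T].

    It remains to see that the quotient by [T] is defined.  This holds for every
    scheme whose relations are all symmetric ([symmetric_quotient_defined]), and
    the orbital scheme is such a scheme because [-1] is a unit.  The key is
    [sim_move]: if [a ~ b], then the first endpoint of any pair in [R_a] can be
    moved inside its [E]-class so as to land in [R_b]; conversely such a move
    witnesses [a ~ b].  So [~] is an equivalence relation, and the class of the
    index of [(x, y)] depends only on the classes of [x] and [y] ([quot_relE]).
    The intersection numbers of the quotient come from counting points of [X]
    instead of points of the quotient: all [E]-classes have the same size
    ([card_point_class]), and the points [z] with prescribed index classes for
    [(x, z)] and [(z, y)] fill whole [E]-classes. *)

Import GRing.Theory.
Local Open Scope ring_scope.

Set Implicit Arguments.
Unset Strict Implicit.

(** * Relations of an association scheme *)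

Section Scheme.

Variables (X I : finType) (i0 : I) (S : assoc_scheme X i0).
Implicit Types (T : {set I}) (a b i j k : I) (x y z : X).

Lemma arel_eq i j x y : (x, y) \in arel S i -> (x, y) \in arel S j -> i = j.
Proof.
move=> xyi xyj; have /and3P[_ /trivIsetP tI _] := arel_partition S.
apply: (@arel_inj _ _ _ S); apply/eqP; apply: contraLR xyi => nij.
have := tI _ _ (imset_f _ (erefl (i \in I))) (imset_f _ (erefl (j \in I))) nij.
by rewrite disjoint_sym => /disjointFr ->.
Qed.

Lemma arel_cover x y : exists i, (x, y) \in arel S i.
Proof.
have /and3P[/eqP cov _ _] := arel_partition S.
have := in_setT (x, y); rewrite -cov => /bigcupP[_ /imsetP[i _ ->]].
by exists i.
Qed.

Lemma arel_neq0 i : exists x y, (x, y) \in arel S i.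
Proof.
have /and3P[_ _ n0] := arel_partition S.
have /set0Pn[[x y] xyi] : arel S i != set0.
  by apply: contraNneq n0 => <-; apply: imset_f.
by exists x, y.
Qed.

Lemma mem_arel0 x y : ((x, y) \in arel S i0) = (x == y).
Proof.
by rewrite arel_diag; apply/imsetP/eqP => [[z _ [-> ->]]|->] //; exists y.
Qed.

(** A triangle of type [(i, j)] over [(x, y)] is a point [z] with [(x, z)] in
    [R_i] and [(z, y)] in [R_j].  One such triangle over one pair of [R_k] yields
    one over every pair of [R_k]: this is how triangles are transported. *)
Lemma inum_neq0P i j k x y : (x, y) \in arel S k ->
  reflect (exists z, (x, z) \in arel S i /\ (z, y) \in arel S j)
          (inum S i j k != 0%N).
Proof.
move=> /inumP <-; rewrite cards_eq0; apply: (iffP (set0Pn _)) => -[z xzy].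
  by exists z; move: xzy; rewrite inE => /andP.
by exists z; rewrite inE; apply/andP.
Qed.

Lemma arel_unionP T x y :
  reflect (exists2 i, i \in T & (x, y) \in arel S i) ((x, y) \in arel_union S T).
Proof. exact: bigcupP. Qed.

Lemma arel_union_mem T k x y :
  (x, y) \in arel S k -> ((x, y) \in arel_union S T) = (k \in T).
Proof.
move=> xyk; apply/arel_unionP/idP => [[i iT /arel_eq e]|kT]; last by exists k.
by rewrite -(e _ xyk).
Qed.

(** A relation of the quotient pulls back to a union of relations on [X], so
    its intersection numbers are obtained from counts of this form. *)
Lemma sum_card_arel (U V : {set I}) k x y : (x, y) \in arel S k ->
  (\sum_(i in U) \sum_(j in V) inum S i j k)%N =
  #|[set z | ((x, z) \in arel_union S U) && ((z, y) \in arel_union S V)]|.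
Proof.
move=> xyk; under eq_bigr => i _ do under eq_bigr => j _ do
  rewrite -(inumP i j xyk) -sum1_card big_mkcond.
rewrite -sum1_card [RHS]big_mkcond.
under eq_bigr => i _ do rewrite exchange_big.
rewrite exchange_big; apply: eq_bigr => z _ /=.
have [i xzi] := arel_cover x z; have [j zyj] := arel_cover z y.
(* Exactly one pair of indices is realized by x, z, y, so z contributes a
   single 1 to the double sum, or nothing. *)
have e i' j' :
    (if z \in [set t | ((x, t) \in arel S i') && ((t, y) \in arel S j')]
     then 1 else 0)%N = ((i' == i) && (j' == j) : nat).
  rewrite inE; case: ifP => [/andP[/(arel_eq xzi) <- /(arel_eq zyj) <-]|].
    by rewrite !eqxx.
  by case: eqP => [->|//]; case: eqP => [->|//]; rewrite xzi zyj.
under eq_bigr => i' _ do under eq_bigr => j' _ do rewrite e.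
rewrite inE (arel_union_mem U xzi) (arel_union_mem V zyj).
have [iU|iU] /= := boolP (i \in U); last first.
  rewrite big1 // => i' i'U; rewrite big1 // => j' _.
  by case: eqP i'U iU => [-> ->|].
rewrite (bigD1 i) //= [X in (_ + X)%N]big1 ?addn0; last first.
  by move=> i' /andP[_ /negPf ->]; rewrite big1.
have [jV|jV] := boolP (j \in V); last first.
  by rewrite big1 // => j' j'V; case: (j' =P j) j'V jV => [-> ->|]; rewrite ?andbF.
rewrite (bigD1 j) //= !eqxx big1 ?addn0 // => j' /andP[_ /negPf ->].
by rewrite andbF.
Qed.

End Scheme.

(** * Quotients of symmetric schemes *)

Section SymmetricQuotient.

Variables (X I : finType) (i0 : I) (S : assoc_scheme X i0).
Hypothesis arel_sym : forall i x y, (x, y) \in arel S i -> (y, x) \in arel S i.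

Variable T : {set I}.
Hypothesis eqvT : is_equivalence (arel_union S T).

Implicit Types (a b c i j k : I) (x y z : X).
Implicit Types (A B : quot_point S T) (C D F : quot_index S T).

Local Notation E := (fun x y => (x, y) \in arel_union S T).

Let E_refl x : E x x.
Proof. by case: (eqvT x x x). Qed.

Let E_sym x y : E x y = E y x.
Proof.
apply/idP/idP => xy; first by have [_ <-] := eqvT x y x.
by have [_ <-] := eqvT y x y.
Qed.

Let E_trans y x z : E x y -> E y z -> E x z.
Proof. by move=> xy; have [_ ->] := eqvT x y z. Qed.

Lemma sim_intro a b x y z :
  E x y -> (x, z) \in arel S a -> (y, z) \in arel S b -> sim S T a b.
Proof.
move=> /arel_unionP[i iT xyi] xza yzb; apply/existsP; exists i.
rewrite iT; apply/(inum_neq0P _ _ xyi); exists z; split=> //.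
exact: arel_sym.
Qed.

(** A triangle with sides [a], [b] and a third side [i] in [T], seen from its
    side [a], says that the number for [(i, b)] over [R_a] is nonzero.  Hence a
    triangle of this shape sits on every pair of [R_a], in particular [(x, z)]. *)
Lemma sim_move a b x z : sim S T a b -> (x, z) \in arel S a ->
  exists2 y, E x y & (y, z) \in arel S b.
Proof.
case/existsP=> i /andP[iT]; have [u [v uvi]] := arel_neq0 S i.
move=> /(inum_neq0P _ _ uvi)[w [uwa wvb]] xza.
have : inum S i b a != 0%N.
  by apply/(inum_neq0P _ _ uwa); exists v; split=> //; apply: arel_sym.
move=> /(inum_neq0P _ _ xza)[y [xyi yzb]]; exists y => //.
by apply/arel_unionP; exists i.
Qed.

Lemma sim_equivalence : equivalence_rel (sim S T).
Proof.
have refl a : sim S T a a.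
  by have [x [y xya]] := arel_neq0 S a; exact: (sim_intro (E_refl x) xya xya).
have sym a b : sim S T a b -> sim S T b a.
  have [x [z xza]] := arel_neq0 S a => /sim_move/(_ xza)[y xy yzb].
  by apply: sim_intro yzb xza; rewrite E_sym.
have trans b a c : sim S T a b -> sim S T b c -> sim S T a c.
  have [x [z xza]] := arel_neq0 S a => /sim_move/(_ xza)[y xy yzb].
  move=> /sim_move/(_ yzb)[w yw wzc].
  exact: sim_intro (E_trans xy yw) xza wzc.
move=> a b c; split=> // ab; apply/idP/idP; last exact: trans.
by apply: trans; apply: sym.
Qed.

Lemma index_class0E : index_class S T i0 = T.
Proof.
apply/setP=> b; rewrite inE; have [x [y xyb]] := arel_neq0 S b.
apply/idP/idP => [|bT].
  have xx : (x, x) \in arel S i0 by rewrite mem_arel0.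
  case/sim_move/(_ xx)=> y' xy' y'xb.
  by rewrite -(arel_union_mem T y'xb) E_sym.
apply: (@sim_intro _ _ y x y); rewrite ?mem_arel0 //.
by rewrite E_sym (arel_union_mem T xyb).
Qed.

Lemma quot_index_class C k : k \in sval C -> sval C = index_class S T k.
Proof.
case: C => _ /= /imsetP[a _ ->]; rewrite inE => ak.
by apply/setP=> b; rewrite !inE; have [_ ->] := sim_equivalence a k b.
Qed.

Lemma mem_quot_index k : exists C, k \in sval C.
Proof.
have kC : index_class S T k \in [set index_class S T a | a : I].
  exact: imset_f.
exists (exist _ (index_class S T k) kC) => /=.
by rewrite inE; have [] := sim_equivalence k k k.
Qed.

Lemma quot_index_eq C D k : k \in sval C -> k \in sval D -> C = D.
Proof.
move=> /quot_index_class eC /quot_index_class eD.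
by apply: val_inj; rewrite /= eC eD.
Qed.

Lemma quot_index_neq0 C : exists k, k \in sval C.
Proof.
case: C => _ /= /imsetP[a _ ->]; exists a.
by rewrite inE; have [] := sim_equivalence a a a.
Qed.

Fact mem_point_class x : point_class S T x \in [set point_class S T y | y : X].
Proof. exact: imset_f. Qed.

Definition class_point x : quot_point S T :=
  exist _ (point_class S T x) (mem_point_class x).

Lemma quot_pointE x A : (x \in sval A) = (A == class_point x).
Proof.
have /imsetP[a _ eA] := svalP A.
apply/idP/eqP => [|->]; last by rewrite inE.
rewrite eA inE => ax; apply: val_inj; rewrite [LHS]eA /=.
by apply/setP=> y; rewrite !inE; have [_ ->] := eqvT a x y.
Qed.

Lemma quot_point_neq0 A : exists x, A = class_point x.
Proof.
by have /imsetP[x _ eA] := svalP A; exists x; apply: val_inj; exact: eA.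
Qed.

Lemma class_point_eq x y : (class_point x == class_point y) = E x y.
Proof. by rewrite -quot_pointE inE. Qed.

(** Although [quot_rel] quantifies over all representatives, one pair of them
    decides: moving the two endpoints one after the other inside their classes
    replaces the index by one in relation [~] with it. *)
Lemma quot_relE C k x y : (x, y) \in arel S k ->
  ((class_point x, class_point y) \in quot_rel C) = (k \in sval C).
Proof.
move=> xyk; rewrite inE /=; apply/idP/idP.
  move=> /forallP/(_ x)/implyP; rewrite inE => /(_ (E_refl x)).
  move=> /forallP/(_ y)/implyP; rewrite inE => /(_ (E_refl y)).
  by case/existsP=> j /andP[jC /(arel_eq xyk) ->].
move=> /quot_index_class ->.
apply/forallP=> x'; apply/implyP; rewrite inE => xx'.
apply/forallP=> y'; apply/implyP; rewrite inE => yy'.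
have [j x'y'j] := arel_cover S x' y'; have [l x'yl] := arel_cover S x' y.
apply/existsP; exists j; rewrite x'y'j andbT inE.
have [_ ->] := sim_equivalence k l j; last exact: sim_intro xx' xyk x'yl.
exact: sim_intro yy' (arel_sym x'yl) (arel_sym x'y'j).
Qed.

(** Every index of the class [C] is realized between any two points of the
    quotient related by [C], so numbers computed from one fixed index of [C]
    are valid for all these pairs. *)
Lemma quot_rel_witness C k A B : (A, B) \in quot_rel C -> k \in sval C ->
  exists x y, [/\ A = class_point x, B = class_point y & (x, y) \in arel S k].
Proof.
have [x ->] := quot_point_neq0 A; have [y ->] := quot_point_neq0 B.
have [j xyj] := arel_cover S x y; rewrite (quot_relE _ xyj) => /quot_index_class ->.
rewrite inE => /sim_move/(_ xyj)[x' xx' x'yk].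
by exists x', y; split=> //; apply/eqP; rewrite class_point_eq.
Qed.

Let class_size : nat := (\sum_(i in T) inum S i i i0)%N.

(** By symmetry the points [y] with [(x, y)] in [R_i] are the triangles
    [x, y, x] of type [(i, i)], and their number does not depend on [x]. *)
Lemma card_point_class x : #|point_class S T x| = class_size.
Proof.
have xx : (x, x) \in arel S i0 by rewrite mem_arel0.
(* With j unconstrained only the terms j = i survive, since a path x, z, x
   uses the same relation twice. *)
transitivity (\sum_(i in T) \sum_(j in setT) inum S i j i0)%N.
  rewrite (sum_card_arel _ _ xx); apply: eq_card => z; rewrite !inE.
  have [j zxj] := arel_cover S z x.
  by rewrite (arel_union_mem _ zxj) inE andbT.
apply: eq_bigr => i _; rewrite (bigD1 i) ?inE //= big1 ?addn0 //.
move=> j /andP[_ nij]; apply/eqP; apply/negPn/(inum_neq0P i j xx).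
by case=> z [/arel_sym zxi /(arel_eq zxi) ij]; rewrite ij eqxx in nij.
Qed.

Definition quot_repr F : I := xchoose (quot_index_neq0 F).

(** The numerator counts, over a pair of index [quot_repr F], the points of [X]
    whose classes are to be counted; each class contributes [class_size] points. *)
Definition quot_inum C D F : nat :=
  ((\sum_(i in sval C) \sum_(j in sval D) inum S i j (quot_repr F)) %/ class_size)%N.

Lemma quot_inumP C D F A B : (A, B) \in quot_rel F ->
  #|[set Z | ((A, Z) \in quot_rel C) && ((Z, B) \in quot_rel D)]|
    = quot_inum C D F.
Proof.
move=> /quot_rel_witness/(_ (xchooseP (quot_index_neq0 F)))[x [y [-> -> xyk]]].
rewrite /quot_inum (sum_card_arel _ _ xyk).
set W := [set Z | _]; set P := [set z | _].
(* P is the union of the classes belonging to W. *)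
have PW z : (z \in P) = (class_point z \in W).
  have [i xzi] := arel_cover S x z; have [j zyj] := arel_cover S z y.
  rewrite [LHS]inE [RHS]inE (quot_relE _ xzi) (quot_relE _ zyj).
  by rewrite (arel_union_mem _ xzi) (arel_union_mem _ zyj).
have class_size_gt0 : (0 < class_size)%N.
  by rewrite -(card_point_class x); apply/card_gt0P; exists x; rewrite inE.
suff -> : #|P| = (#|W| * class_size)%N by rewrite mulnK.
rewrite -sum1_card (partition_big class_point (mem W)) => [|z]; last by rewrite PW.
rewrite -sum_nat_const; apply: eq_bigr => Z ZW.
have [z eZ] := quot_point_neq0 Z; rewrite -(card_point_class z) -sum1_card.
apply: eq_bigl => t; rewrite PW [in RHS]inE.
have [e|] := eqVneq; last by rewrite andbF eZ eq_sym class_point_eq => /negPf->.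
by rewrite e (ZW : Z \in W) -class_point_eq e eZ eqxx.
Qed.

Lemma quot_inumC C D F : quot_inum C D F = quot_inum D C F.
Proof.
rewrite /quot_inum exchange_big; congr (_ %/ _)%N.
by apply: eq_bigr => i _; apply: eq_bigr => j _; rewrite inumC.
Qed.

Lemma quot_rel_inj : injective (@quot_rel _ _ _ S T).
Proof.
move=> C D /setP e; have [k kC] := quot_index_neq0 C.
have [x [y xyk]] := arel_neq0 S k; apply: (quot_index_eq kC).
by rewrite -(quot_relE _ xyk) -e (quot_relE _ xyk).
Qed.

Lemma quot_rel_partition :
  partition [set quot_rel C | C : quot_index S T]
            [set: quot_point S T * quot_point S T].
Proof.
apply/and3P; split.
- apply/eqP/setP=> -[A B]; rewrite inE; apply/bigcupP.
  have [x ->] := quot_point_neq0 A; have [y ->] := quot_point_neq0 B.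
  have [k xyk] := arel_cover S x y; have [C kC] := mem_quot_index k.
  by exists (quot_rel C); [apply: imset_f | rewrite (quot_relE _ xyk)].
- apply/trivIsetP=> _ _ /imsetP[C _ ->] /imsetP[D _ ->] nCD.
  rewrite -setI_eq0; apply: contraNT nCD => /set0Pn[[A B]].
  rewrite inE => /andP[]; have [k kC] := quot_index_neq0 C.
  move=> /quot_rel_witness/(_ kC)[x [y [-> -> xyk]]].
  by rewrite (quot_relE _ xyk) => /(quot_index_eq kC) ->.
- apply/imsetP=> -[C _ e]; have [k kC] := quot_index_neq0 C.
  have [x [y xyk]] := arel_neq0 S k.
  by rewrite -(quot_relE _ xyk) -e inE in kC.
Qed.

Lemma quot_rel_sym C A B : (A, B) \in quot_rel C -> (B, A) \in quot_rel C.
Proof.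
have [k kC] := quot_index_neq0 C.
move=> /quot_rel_witness/(_ kC)[x [y [-> -> /arel_sym yxk]]].
by rewrite (quot_relE _ yxk).
Qed.

Lemma quot_rel_tr C :
  exists D, [set (AB.2, AB.1) | AB in quot_rel C] = quot_rel D.
Proof.
exists C; apply/setP=> -[A B]; apply/imsetP/idP => [[[A' B'] + [-> ->]]|BA].
  exact: quot_rel_sym.
by exists (B, A) => //; apply: quot_rel_sym.
Qed.

Lemma quot_rel_diag :
  quot_rel (quot_index0 S T) = [set (A, A) | A : quot_point S T].
Proof.
apply/setP=> -[A B].
have [x ->] := quot_point_neq0 A; have [y ->] := quot_point_neq0 B.
have [k xyk] := arel_cover S x y.
rewrite (quot_relE _ xyk) /= index_class0E -(arel_union_mem T xyk).
rewrite -class_point_eq.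
by apply/eqP/imsetP => [->|[Z _ [-> ->]]] //; exists (class_point y).
Qed.

Theorem symmetric_quotient_defined : quotient_defined S T.
Proof.
split=> //; first exact: sim_equivalence; first exact: index_class0E.
by exists (AssocScheme quot_rel_inj quot_rel_partition quot_rel_tr quot_rel_diag
  quot_inumP quot_inumC).
Qed.

End SymmetricQuotient.

(** * Ideals of the Gaussian quotient ring *)

Section Ideal.

Variables (alpha : gaussInt) (alpha_neq0 : alpha != 0).
Local Notation L := (gquot alpha_neq0).
Local Notation qI := (qI alpha_neq0).
Implicit Types x y z : L.

Lemma gpi_int (m : int) : gpi alpha_neq0 (GaussInt m 0) = m%:~R.
Proof.
have nat n : gpi alpha_neq0 (GaussInt (Posz n) 0) = n%:R.
  elim: n => [|n IHn]; first exact: gpi0.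
  have -> : GaussInt (Posz n.+1) 0 = GaussInt (Posz n) 0 + 1.
    by rewrite -addn1 PoszD.
  by rewrite gpiD IHn -natr1.
case: m => n; first exact: nat.
by rewrite NegzE mulrNz -[n.+1%:~R]/(n.+1%:R) -nat -gpiN.
Qed.

Lemma gquot_gen x : exists a b : int, x = a%:~R + qI * b%:~R.
Proof.
exists (gre (grepr x)), (gim (grepr x)).
rewrite -!gpi_int -[qI * _]gpiM -gpiD -[LHS]greprK; congr (gpi _ _).
by case: (grepr x) => a b; congr GaussInt; rewrite /=
  !(mul0r, mul1r, subr0, addr0, add0r).
Qed.

Variable J : {set L}.
Hypothesis JB : forall x y, x \in J -> y \in J -> x - y \in J.
Hypothesis JI : forall x, x \in J -> qI * x \in J.

(** Additive closure and stability under [i] suffice, as [1] and [i] generate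
    the ring additively. *)
Lemma ideal_mul z x : x \in J -> z * x \in J.
Proof.
move=> xJ; have J0 : 0 \in J by rewrite -(subrr x) JB.
have JN y : y \in J -> - y \in J by move=> yJ; rewrite -sub0r JB.
have JD y t : y \in J -> t \in J -> y + t \in J.
  by move=> yJ tJ; rewrite -[t]opprK JB ?JN.
have Jn n : x *+ n \in J by elim: n => [|n IHn] //; rewrite mulrS JD.
have Jz (m : int) : m%:~R * x \in J.
  by rewrite mulrzl; case: m => n; [apply: Jn | apply: JN; apply: Jn].
by have [a [b ->]] := gquot_gen z; rewrite mulrDl -mulrA JD ?JI.
Qed.

(** Multiplication by [x] has its image in the proper subset [J] of the finite
    ring, so it cannot be injective. *)
Lemma proper_ideal_zero_divisor x :
  J != setT -> x \in J -> zero_divisor x.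
Proof.
move=> properJ xJ; have /injectivePn[u [v nuv e]] : ~~ injectiveb ( *%R x).
  apply: contra properJ => /injectiveP injx; rewrite -subTset.
  apply/subsetP=> z _; have [g _ gK] := injF_bij injx.
  by rewrite -(gK z) mulrC ideal_mul.
by exists (u - v); rewrite ?subr_eq0 // mulrBr e subrr.
Qed.

End Ideal.

(** * The orbital scheme *)

Theorem proposition15 (alpha : gaussInt) (alpha_neq0 : alpha != 0)
    (d : nat) (S : assoc_scheme (gquot alpha_neq0) (ord0 : 'I_d.+1))
    (O : 'I_d.+1 -> {set gquot alpha_neq0}) :
  is_orbital_scheme S O ->
  imprimitive S ->
  exists Z : {set gquot alpha_neq0},
    [/\ Z != set0,
        forall x, x \in Z -> x != 0 /\ zero_divisor x
      & quotient_defined S (ord0 |: [set k | [exists x in Z, x \in O k]])].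
Proof.
move=> [_ orbO relO] [T [eqvT nontriv proper]].
have orb k x : x \in O k -> O k = orbit 'P (unit_group alpha_neq0) x.
  have : O k \in unit_orbits alpha_neq0 by rewrite -orbO imset_f.
  by case/imsetP=> r _ -> /orbit_in_eqP -> //; apply: subsetT.
have sym k x y : (x, y) \in arel S k -> (y, x) \in arel S k.
  rewrite !relO => xyk; rewrite (orb _ _ xyk).
  by have := unit_orbitN (x - y) (y - x); rewrite opprB orbit_refl => <-.
pose J := [set x | (x, 0) \in arel_union S T].
have memJ x y : ((x, y) \in arel_union S T) = (x - y \in J).
  rewrite inE; apply/arel_unionP/arel_unionP => -[k kT xyk]; exists k => //;
  by move: xyk; rewrite !relO subr0.
have refl x : (x, x) \in arel_union S T by case: (eqvT x x x).
have JB x y : x \in J -> y \in J -> x - y \in J.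
  rewrite -memJ !inE => x0 y0; have [_ <-] := eqvT y x y => //.
  by have [_ ->] := eqvT y 0 x; [have [_ <-] := eqvT x 0 x|].
have JI x : x \in J -> qI alpha_neq0 * x \in J.
  rewrite !inE => /arel_unionP[k kT]; rewrite relO subr0 => xk.
  apply/arel_unionP; exists k; rewrite // relO subr0.
  by rewrite (orb _ _ xk) -(expr1 (qI _)) unit_orbitM orbit_refl.
have properJ : J != setT.
  apply: contraNneq proper => eJ; apply/eqP/setP=> -[x y].
  by rewrite memJ eJ !inE.
have T0 : ord0 \in T.
  by rewrite -(arel_union_mem (S := S) T (x := 0) (y := 0)) ?mem_arel0.
exists (J :\ 0); split.
- apply: contraNneq nontriv => /eqP; rewrite setD_eq0 subset1 => eJ.
  apply/eqP/setP=> -[x y]; rewrite memJ mem_arel0 -subr_eq0.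
  have J0 : 0 \in J by rewrite -(subrr 0) -memJ.
  by case/orP: eJ J0 => /eqP ->; rewrite !inE.
- move=> x; rewrite !inE => /andP[x0 xJ]; split=> //.
  by apply: (proper_ideal_zero_divisor JB JI) => //; rewrite inE.
suff -> : ord0 |: [set k | [exists x in J :\ 0, x \in O k]] = T.
  exact: symmetric_quotient_defined.
apply/setP=> k; rewrite !inE; have [->|k0] //= := eqVneq k ord0.
apply/exists_inP/idP => [[x]|kT].
  rewrite !inE => /andP[_ xJ] xk.
  by rewrite -(arel_union_mem (S := S) T (x := x) (y := 0)) // relO subr0.
have [x [y xyk]] := arel_neq0 S k; exists (x - y); last by rewrite -relO.
rewrite in_setD1 -memJ (arel_union_mem T xyk) kT andbT subr_eq0 -(mem_arel0 S).
by apply: contraNN k0 => /(arel_eq xyk) ->.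
Qed.
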